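(* The class of all algebras $(S,[\ ],{}',{}^\wedge)$ of type $(3,1,1)$ that arise from inverse semigroups $S$ by putting $[xyz]=xy^{-1}z$, $x'=x^{-1}$ and $x^\wedge=x^{-1}x$ for $x,y,z\in S$ is a variety of algebras (i.e. it is the class of all algebras of type $(3,1,1)$ satisfying some set of identities).
   Context: The ternary operation $[xyz]=xy^{-1}z$ on an inverse semigroup $S$ is called its standard ternary operation. An algebra of type $(3,1,1)$ is a set with one ternary operation $[\ ]$ and two unary operations ${}'$ and ${}^\wedge$. *)

(* Defs.v *)
From Stdlib Require Import ClassicalEpsilon.

Set Implicit Arguments.
Unset Strict Implicit.

(** Algebras of type (3,1,1), terms, identities, varieties *)

(* The carrier is an arbitrary set, possibly empty. *)
Record algebra311 : Type := Algebra311 {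
  carrier :> Type;
  tern : carrier -> carrier -> carrier -> carrier;
  prime : carrier -> carrier;
  hat : carrier -> carrier
}.

(* An identity involves finitely many variables, so a countable supply is
   enough. *)
Inductive term : Set :=
  | Var : nat -> term
  | Tern : term -> term -> term -> term
  | Prime : term -> term
  | Hat : term -> term.

Fixpoint eval (A : algebra311) (v : nat -> A) (t : term) : A :=
  match t with
  | Var n => v n
  | Tern r s t => tern (eval v r) (eval v s) (eval v t)
  | Prime t => prime (eval v t)
  | Hat t => hat (eval v t)
  end.

Definition identity : Set := (term * term)%type.

Definition satisfies (A : algebra311) (e : identity) : Prop :=
  forall v : nat -> A, eval v (fst e) = eval v (snd e).

Definition is_variety (K : algebra311 -> Prop) : Prop :=
  exists E : identity -> Prop,
    forall A : algebra311, K A <-> (forall e, E e -> satisfies A e).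

(** Inverse semigroups *)

Definition is_inverse (T : Type) (mul : T -> T -> T) (x y : T) : Prop :=
  mul (mul x y) x = x /\ mul (mul y x) y = y.

Record inverse_semigroup (T : Type) : Type := InverseSemigroup {
  mul : T -> T -> T;
  mul_assoc : forall x y z, mul x (mul y z) = mul (mul x y) z;
  inverse_unique : forall x, exists! y, is_inverse mul x y
}.

(* The unique inverse, extracted from [inverse_unique] by description. *)
Definition inv (T : Type) (S : inverse_semigroup T) (x : T) : T :=
  proj1_sig (constructive_indefinite_description _ (inverse_unique S x)).

Definition standard_ternary (T : Type) (S : inverse_semigroup T)
    (x y z : T) : T :=
  mul S (mul S x (inv S y)) z.

Definition arises_from_inverse_semigroup (A : algebra311) : Prop :=
  exists S : inverse_semigroup A,
    (forall x y z : A, tern x y z = standard_ternary S x y z) /\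
    (forall x : A, prime x = inv S x) /\
    (forall x : A, hat x = mul S (inv S x) x).

(* Main.v *)
Require Import Defs.

(** In an inverse semigroup [x (x^-1 x)^-1 y = x x^-1 x y = x y], so the
    multiplication is the term operation [[x x^ y]].  The class is therefore
    axiomatized by the identities of inverse semigroups as algebras of type
    (2,1), read through this term, together with the two identities expressing
    [[xyz]] and [x^] by the multiplication and the inversion. *)

Set Implicit Arguments.
Unset Strict Implicit.

(** * Unique inverses versus commuting idempotents *)

Section Semigroup.

Variables (T : Type) (m : T -> T -> T).
Hypothesis assoc : forall x y z, m x (m y z) = m (m x y) z.

Local Infix "*" := m.

Lemma is_inverse_sym x y : is_inverse m x y -> is_inverse m y x.
Proof. intros [H1 H2]; split; assumption. Qed.

Lemma is_inverse_idempotent e : e * e = e -> is_inverse m e e.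
Proof. intros He; split; rewrite !He; reflexivity. Qed.

Lemma is_inverse_mul_idempotent x y :
  is_inverse m x y -> (x * y) * (x * y) = x * y.
Proof. intros [H _]. rewrite assoc, H. reflexivity. Qed.

Section UniqueInverses.

Hypothesis unique_inverse :
  forall x y z, is_inverse m x y -> is_inverse m x z -> y = z.
Hypothesis regular : forall x, exists y, is_inverse m x y.

Lemma idempotent_mul e f :
  e * e = e -> f * f = f -> (e * f) * (e * f) = e * f.
Proof.
intros He Hf.
(* Products are kept associated to the left, so the absorption rules carry an arbitrary left factor
   [a] in order to rewrite inside longer products. *)
assert (Ke : forall a, a * e * e = a * e) by (intros; rewrite <- assoc, He; reflexivity).
assert (Kf : forall a, a * f * f = a * f) by (intros; rewrite <- assoc, Hf; reflexivity).
destruct (regular (e * f)) as [x [H1 H2]].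
rewrite !assoc in H1, H2.
assert (Kx : forall a, a * x * e * f * x = a * x).
{ intros a. rewrite <- H2 at 3. rewrite !assoc. reflexivity. }
(* [f x e] is another inverse of [e f], so it equals [x]; it is visibly
   idempotent, hence its own inverse, hence equal to [e f]. *)
assert (Hx : x = f * x * e).
{ apply (unique_inverse (x := e * f)).
  - split; rewrite !assoc; assumption.
  - split; rewrite !assoc, ?Kf, ?Ke.
    + exact H1.
    + rewrite Kx. reflexivity. }
assert (Hxx : x * x = x).
{ transitivity (f * x * e * (f * x * e)).
  - rewrite <- Hx. reflexivity.
  - rewrite !assoc, Kx. symmetry. exact Hx. }
assert (Hef : e * f = x).
{ apply (unique_inverse (x := x)).
  - split; rewrite !assoc; assumption.
  - apply is_inverse_idempotent, Hxx. }
rewrite Hef. exact Hxx.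
Qed.

(** Since [e * f] and [f * e] are idempotent, both of them are inverses of [e * f]. *)
Lemma idempotents_commute e f : e * e = e -> f * f = f -> e * f = f * e.
Proof.
intros He Hf.
assert (Ke : forall a, a * e * e = a * e) by (intros; rewrite <- assoc, He; reflexivity).
assert (Kf : forall a, a * f * f = a * f) by (intros; rewrite <- assoc, Hf; reflexivity).
pose proof (idempotent_mul He Hf) as Hef.
pose proof (idempotent_mul Hf He) as Hfe.
apply (unique_inverse (x := e * f)).
- apply is_inverse_idempotent, Hef.
- rewrite assoc in Hef, Hfe.
  split; rewrite !assoc, ?Ke, ?Kf, ?Ke; assumption.
Qed.

End UniqueInverses.

(** Both inverses equal [y * x * z]: in [y = y * (x * z) * (x * y)] commute [x * z] with [x * y],
    and in [z = (z * x) * (y * x) * z] commute [z * x] with [y * x]. *)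
Lemma commuting_idempotents_unique_inverse :
  (forall e f, e * e = e -> f * f = f -> e * f = f * e) ->
  forall x y z, is_inverse m x y -> is_inverse m x z -> y = z.
Proof.
intros C x y z Hy Hz.
pose proof (C _ _ (is_inverse_mul_idempotent Hz)
                  (is_inverse_mul_idempotent Hy)) as C1.
pose proof (C _ _ (is_inverse_mul_idempotent (is_inverse_sym Hz))
                  (is_inverse_mul_idempotent (is_inverse_sym Hy))) as C2.
destruct Hy as [Hy1 Hy2], Hz as [Hz1 Hz2].
rewrite !assoc in C1, C2.
transitivity (y * x * z).
- transitivity (y * (x * z * x * y)).
  + rewrite Hz1, assoc, Hy2. reflexivity.
  + rewrite C1, Hy1, assoc. reflexivity.
- transitivity (z * x * y * x * z).
  + rewrite C2, <- !assoc, (assoc z), Hz2. reflexivity.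
  + rewrite <- (assoc z x), <- (assoc z), Hy1. exact Hz2.
Qed.

(** * Inverse semigroups described by identities on a unary operation *)

Section Involution.

Variable star : T -> T.
Hypothesis star_regular : forall x, x * star x * x = x.
Hypothesis star_involutive : forall x, star (star x) = x.
Hypothesis star_commute :
  forall x y, (x * star x) * (y * star y) = (y * star y) * (x * star x).

Lemma star_is_inverse x : is_inverse m x (star x).
Proof.
split.
- apply star_regular.
- rewrite <- (star_involutive x) at 2. apply star_regular.
Qed.

(** An identity can only make the elements [x * star x] commute; this lemma shows that every
    idempotent is of that form. Replacing [e] by [e * e] in [star e * e * star e] and commuting the
    two halves gives [star e = (e * star e) * (star e * e)]. Hence [star e] absorbs [e] on both
    sides, so [star e = e * star e * e = e]. *)
Lemma idempotent_eq_mul_star e : e * e = e -> e = e * star e.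
Proof.
intros He.
assert (H : star e = e * star e * (star e * e)).
{ rewrite <- (star_involutive e) at 5.
  rewrite star_commute, star_involutive, assoc, <- (assoc (star e)), He.
  symmetry. apply star_is_inverse. }
assert (Hs : star e = e).
{ transitivity (e * star e * e).
  - rewrite H at 2. rewrite !assoc, He, <- (assoc _ e e), He, <- assoc. exact H.
  - apply star_regular. }
rewrite Hs. symmetry. exact He.
Qed.

Lemma star_idempotents_commute e f : e * e = e -> f * f = f -> e * f = f * e.
Proof.
intros He Hf.
rewrite (idempotent_eq_mul_star He), (idempotent_eq_mul_star Hf).
apply star_commute.
Qed.

Lemma star_unique_inverse x : exists! y, is_inverse m x y.
Proof.
exists (star x). split.
- apply star_is_inverse.
- intros y Hy.
  exact (commuting_idempotents_unique_inverse star_idempotents_commute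
           (star_is_inverse x) Hy).
Qed.

End Involution.

End Semigroup.

(** * Laws of inversion in an inverse semigroup *)

Section InverseSemigroup.

Variables (T : Type) (S : inverse_semigroup T).

Lemma inv_is_inverse x : is_inverse (mul S) x (inv S x).
Proof.
unfold inv.
destruct ClassicalEpsilon.constructive_indefinite_description as [y [Hy U]].
exact Hy.
Qed.

Lemma inverse_semigroup_unique x y z :
  is_inverse (mul S) x y -> is_inverse (mul S) x z -> y = z.
Proof.
intros Hy Hz. destruct (inverse_unique S x) as [w [_ U]].
rewrite <- (U y Hy). apply U, Hz.
Qed.

Lemma inv_eq x y : is_inverse (mul S) x y -> inv S x = y.
Proof. apply inverse_semigroup_unique, inv_is_inverse. Qed.

Lemma inv_involutive x : inv S (inv S x) = x.
Proof. apply inv_eq, is_inverse_sym, inv_is_inverse. Qed.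

Lemma mul_inv_commute x y :
  mul S (mul S x (inv S x)) (mul S y (inv S y)) =
  mul S (mul S y (inv S y)) (mul S x (inv S x)).
Proof.
apply idempotents_commute.
- apply mul_assoc.
- apply inverse_semigroup_unique.
- intros z. exists (inv S z). apply inv_is_inverse.
- apply is_inverse_mul_idempotent; [apply mul_assoc | apply inv_is_inverse].
- apply is_inverse_mul_idempotent; [apply mul_assoc | apply inv_is_inverse].
Qed.

Lemma standard_ternary_hat x y :
  standard_ternary S x (mul S (inv S x) x) y = mul S x y.
Proof.
unfold standard_ternary. rewrite (inv_eq (y := mul S (inv S x) x)).
- rewrite mul_assoc, (proj1 (inv_is_inverse x)). reflexivity.
- apply is_inverse_idempotent, is_inverse_mul_idempotent.
  + apply mul_assoc.
  + apply is_inverse_sym, inv_is_inverse.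
Qed.

End InverseSemigroup.

(** * The axioms and the two inclusions *)

Definition Mul (s t : term) : term := Tern s (Hat s) t.

Inductive axiom311 : identity -> Prop :=
  | Ax_tern : axiom311 (Tern (Var 0) (Var 1) (Var 2),
      Mul (Mul (Var 0) (Prime (Var 1))) (Var 2))
  | Ax_hat : axiom311 (Hat (Var 0), Mul (Prime (Var 0)) (Var 0))
  | Ax_assoc : axiom311 (Mul (Var 0) (Mul (Var 1) (Var 2)),
      Mul (Mul (Var 0) (Var 1)) (Var 2))
  | Ax_regular : axiom311 (Mul (Mul (Var 0) (Prime (Var 0))) (Var 0), Var 0)
  | Ax_involutive : axiom311 (Prime (Prime (Var 0)), Var 0)
  | Ax_commute : axiom311
      (Mul (Mul (Var 0) (Prime (Var 0))) (Mul (Var 1) (Prime (Var 1))),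
       Mul (Mul (Var 1) (Prime (Var 1))) (Mul (Var 0) (Prime (Var 0)))).

Lemma arises_satisfies_axiom311 (A : algebra311) (e : identity) :
  arises_from_inverse_semigroup A -> axiom311 e -> satisfies A e.
Proof.
intros [S [Ht [Hp Hh]]] He v.
assert (Hm : forall x y : A, tern x (hat x) y = mul S x y).
{ intros x y. rewrite Ht, Hh. apply standard_ternary_hat. }
destruct He; simpl; rewrite ?Hm, ?Hp.
- apply Ht.
- apply Hh.
- apply mul_assoc.
- apply inv_is_inverse.
- apply inv_involutive.
- apply mul_inv_commute.
Qed.

Lemma axiom311_arises (A : algebra311) :
  (forall e, axiom311 e -> satisfies A e) -> arises_from_inverse_semigroup A.
Proof.
intros H.
pose (m := fun x y : A => tern x (hat x) y).
(* The axioms mention only variables 0, 1 and 2, so the value [z] at later indices is a mere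
   default. Evaluating an axiom under [v] reduces to the law wanted, which [exact] accepts by
   conversion. *)
pose (v := fun (x y z : A) (n : nat) =>
  match n with 0 => x | 1 => y | _ => z end).
assert (assoc : forall x y z, m x (m y z) = m (m x y) z)
  by exact (fun x y z => H _ Ax_assoc (v x y z)).
assert (regular : forall x, m (m x (prime x)) x = x)
  by exact (fun x => H _ Ax_regular (v x x x)).
assert (involutive : forall x : A, prime (prime x) = x)
  by exact (fun x => H _ Ax_involutive (v x x x)).
assert (commute : forall x y, m (m x (prime x)) (m y (prime y)) =
                              m (m y (prime y)) (m x (prime x)))
  by exact (fun x y => H _ Ax_commute (v x y y)).
pose (S := InverseSemigroup assoc
             (star_unique_inverse assoc regular involutive commute)).
(* [inv S] comes from a description and does not compute to [prime]; uniqueness of inverses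
   identifies the two. *)
assert (Hp : forall x : A, prime x = inv S x).
{ intros x. symmetry. apply inv_eq.
  exact (star_is_inverse regular involutive x). }
exists S. split; [|split].
- intros x y z. unfold standard_ternary. rewrite <- Hp.
  exact (H _ Ax_tern (v x y z)).
- exact Hp.
- intros x. rewrite <- Hp. exact (H _ Ax_hat (v x x x)).
Qed.

Theorem corollary90 : is_variety arises_from_inverse_semigroup.
Proof.
exists axiom311. intros A. split.
- intros HA e. apply arises_satisfies_axiom311, HA.
- apply axiom311_arises.
Qed.
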